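(* Let $f(Z)=\sum_{\alpha\in A} c_\alpha Z^\alpha+\sum_{\beta\in B} c_\beta Z^\beta \in \mathbb{C}[Z]$ be a homogeneous non-mixed polynomial of degree $d\ge 3$ on the space of complex symmetric $n\times n$ matrices, where $A$ is the set of exponent matrices of diagonal monomials and $B$ is the set of exponent matrices of off-diagonal monomials. Assume that $c_\beta\neq 0$ for some $\beta\in B$. Then $f$ is not psd-stable.
   Context: $\mathbb{C}[Z]$ denotes the ring of polynomials in the entries $z_{ij}$ of a symmetric $n\times n$ variable matrix $Z=(z_{ij})$, with $z_{ij}$ and $z_{ji}$ identified. Monomials are written $Z^\alpha=\prod_{1\le i,j\le n} z_{ij}^{\alpha_{ij}}$, where $\alpha$ is a symmetric matrix with non-negative entries, whose diagonal entries are integers and whose off-diagonal entries are half-integers (so for $i<j$ the variable $z_{ij}$ has exponent $2\alpha_{ij}$). A monomial $Z^\alpha$ is diagonal if $\alpha_{ij}=0$ for all $i\ne j$, and off-diagonal if $\alpha_{ii}=0$ for all $i$; by convention a constant is a diagonal monomial but not an off-diagonal one. A polynomial is non-mixed if every monomial occurring in it is either diagonal or off-diagonal. A polynomial $f\in\mathbb{C}[Z]$ is psd-stable if $f(M)\ne 0$ for every complex symmetric $n\times n$ matrix $M$ whose entrywise imaginary part $\mathrm{Im}(M)$ is positive definite. *)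

(* Defs.v *)
From mathcomp Require Import all_boot all_order all_algebra.
(* [mpoly] has to be imported before any file of MathComp-Analysis: the other
   order makes their notation levels clash. *)
From mathcomp Require Import complex mpoly.
From mathcomp Require Import reals.

Set Implicit Arguments.
Unset Strict Implicit.
Unset Printing Implicit Defensive.

Import GRing.Theory Num.Theory.
Local Open Scope ring_scope.

(* The entries z_ij of a symmetric variable matrix, z_ij and z_ji being
   identified, are indexed by the pairs (i, j) with i <= j. *)
Notation upair n := {p : 'I_n * 'I_n | (p.1 <= p.2)%N}.

Definition nvars (n : nat) : nat := #|{: upair n}|.

Lemma upair_subproof (n : nat) (i j : 'I_n) :
  let p := if (i <= j)%N then (i, j) else (j, i) in (p.1 <= p.2)%N.
Proof. by rewrite /=; case: (leqP i j) => //= lt_ji; apply: ltnW. Qed.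

Definition mk_upair (n : nat) (i j : 'I_n) : upair n :=
  exist _ (if (i <= j)%N then (i, j) else (j, i)) (upair_subproof i j).

Definition zvar (n : nat) (i j : 'I_n) : 'I_(nvars n) :=
  enum_rank (mk_upair i j).

Notation sympoly K n := {mpoly K[nvars n]}.

(* A monomial m is a plain exponent vector over the variables z_ij, i <= j. Its
   symmetric exponent matrix alpha, for which
   Z^alpha = \prod_(i, j) z_ij ^ alpha_ij, splits the exponent of z_ij evenly
   between the positions (i, j) and (j, i) when i != j. *)
Definition expmx (n : nat) (m : 'X_{1..nvars n}) : 'M[rat]_n :=
  \matrix_(i, j)
    (if i == j then (m (zvar i j))%:R else (m (zvar i j))%:R / 2%:R).

Definition diagonal_mon (n : nat) (m : 'X_{1..nvars n}) : Prop :=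
  forall i j : 'I_n, i != j -> expmx m i j = 0.

(* The constant monomial is diagonal, and by convention not off-diagonal. *)
Definition offdiagonal_mon (n : nat) (m : 'X_{1..nvars n}) : Prop :=
  m != 0%MM /\ forall i : 'I_n, expmx m i i = 0.

Definition non_mixed (K : nzRingType) (n : nat) (f : sympoly K n) : Prop :=
  forall m, m \in msupp f -> diagonal_mon m \/ offdiagonal_mon m.

(* Only the entries M i j with i <= j are read; this is the value f(M) when M
   is symmetric. *)
Definition eval_at (K : comNzRingType) (n : nat) (f : sympoly K n)
    (M : 'M[K]_n) : K :=
  f.@[fun k => M (val (enum_val k)).1 (val (enum_val k)).2].

Definition posdefmx (R : realDomainType) (n : nat) (A : 'M[R]_n) : Prop :=
  A^T = A /\ forall x : 'cV[R]_n, x != 0 -> 0 < (x^T *m A *m x) 0 0.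

Definition psd_stable (R : realType) (n : nat) (f : sympoly R[i] n) : Prop :=
  forall M : 'M[R[i]]_n,
    M^T = M -> posdefmx (map_mx (@complex.Im R) M) -> eval_at f M != 0.

Lemma zvarC (n : nat) (i j : 'I_n) : zvar i j = zvar j i.
Proof.
congr enum_rank; apply: val_inj => /=.
by case: (ltngtP i j) => // /val_inj ->.
Qed.

Lemma eval_at_zvar (K : comNzRingType) (n : nat) (M : 'M[K]_n) (i j : 'I_n) :
  M^T = M -> eval_at ('X_(zvar i j) : sympoly K n) M = M i j.
Proof.
move=> symM; rewrite /eval_at mevalXU enum_rankK /=.
by case: leqP => //= _; rewrite -[in LHS]symM mxE.
Qed.

(* Main.v *)
(** Evaluate [f] at [M = t I + V] with [V] real symmetric of zero diagonal.
Since [f] is homogeneous and non-mixed, [f M = D t^d + g V] with [D] a constant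
and [g] the off-diagonal part of [f]. Stability at [M = i I] forces [D <> 0],
and [g V] is nonzero for some real [V] because [g <> 0]. As [d >= 3], the
equation [t^d = - g V / D] has a non-real solution [t]; then [f] vanishes at
both [M] and [- M], and one of them has positive definite imaginary part. *)
Require Import Defs.
From mathcomp Require Import all_boot all_order all_algebra.
From mathcomp Require Import separable cyclotomic.
From mathcomp Require Import complex mpoly.
From mathcomp Require Import reals.

Set Implicit Arguments.
Unset Strict Implicit.
Unset Printing Implicit Defensive.

Import GRing.Theory Num.Theory.
Local Open Scope ring_scope.

Lemma poly_nat_roots_eq0 (K : numDomainType) (p : {poly K}) :
  (forall j : nat, p.[j%:R] = 0) -> p = 0.
Proof.
move=> p0; apply/eqP/negP => /negP nz_p.
(* In characteristic zero these are [size p] distinct roots, one more than the degree of a nonzero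
   [p]. *)
have /(max_poly_roots nz_p) : all (root p) [seq j%:R | j <- iota 0 (size p)].
  by apply/allP => _ /mapP[j _ ->]; rewrite rootE p0.
rewrite map_inj_uniq ?iota_uniq; last exact: (mulrIn (oner_neq0 K)).
by rewrite size_map size_iota ltnn => /(_ isT).
Qed.

(* Fixing the exponents of one more variable at each step amounts to taking one
   coefficient of a univariate polynomial that vanishes on [nat]. *)
Lemma partial_coef_sum_eq0 (K : numDomainType) (n : nat) (p : {mpoly K[n]}) :
    (forall v : 'I_n -> nat, p.@[fun i => (v i)%:R] = 0) ->
  forall (s : seq 'I_n) (e : 'X_{1..n}) (v : 'I_n -> nat),
    \sum_(m <- msupp p | all (fun i => m i == e i) s)
      p@_m * \prod_(i | i \notin s) (v i)%:R ^+ m i = 0.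
Proof.
move=> p0; elim=> [|k s IHs] e v.
  rewrite -[RHS](p0 v) mevalE; apply: eq_bigr => m _.
  by congr (_ * _); apply: eq_bigl.
have [ks|ksN] := boolP (k \in s).
  rewrite -[RHS](IHs e v); apply: eq_big => [m|m _] /=.
    by case: allP => [/(_ _ ks)->|]; rewrite ?andbF.
  congr (_ * _); apply: eq_bigl => i; rewrite inE negb_or.
  by case: eqVneq => // ->; rewrite ks.
pose c (m : 'X_{1..n}) : K :=
  p@_m * \prod_(i | i \notin k :: s) (v i)%:R ^+ m i.
(* [q] is the sum of the induction hypothesis with the value of variable [k] made an indeterminate;
   its coefficient of index [e k] is the sum for [k :: s]. *)
pose q : {poly K} :=
  \sum_(m <- msupp p | all (fun i => m i == e i) s) c m *: 'X^(m k).
have q0 : q = 0.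
  apply: poly_nat_roots_eq0 => j.
  rewrite -[RHS](IHs e (fun i => if i == k then j else v i)) horner_sum.
  apply: eq_bigr => m _; rewrite hornerZ hornerXn -mulrA; congr (_ * _).
  rewrite (bigD1 (P := fun i => i \notin s) k) //= eqxx mulrC; congr (_ * _).
  apply: eq_big => [i|i]; first by rewrite inE negb_or andbC.
  by rewrite inE negb_or => /andP[/negPf->].
have qk0 : q`_(e k) = 0 by rewrite q0 coef0.
rewrite -[RHS]qk0 coef_sum big_mkcond [RHS]big_mkcond /=.
apply: eq_bigr => m _; rewrite coefZ coefXn eq_sym /c.
by case: eqP => _ /=; [rewrite mulr1 | rewrite mulr0 if_same].
Qed.

(** Once the exponents of all variables are fixed, the partial sum has at most the term of [e], and
    its product is empty. *)
Lemma mcoeff_eq0_of_nat_roots (K : numDomainType) (n : nat) (p : {mpoly K[n]})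
    (e : 'X_{1..n}) :
  (forall v : 'I_n -> nat, p.@[fun i => (v i)%:R] = 0) -> p@_e = 0.
Proof.
move=> p0; apply/eqP/negPn/negP => nz_e.
have := partial_coef_sum_eq0 p0 (enum 'I_n) e (fun=> 0%N).
rewrite big_mkcond (bigD1_seq e) ?mcoeff_msupp ?msupp_uniq //=.
rewrite ifT; last by apply/allP.
rewrite big1 ?mulr1 => [|i]; last by rewrite mem_enum.
rewrite big1 => [|m m_neq_e]; first by rewrite addr0 => /eqP; apply/negP.
case: allP => // em; case/eqP: m_neq_e.
by apply/mnmP => i; apply/eqP/em; rewrite mem_enum.
Qed.

Lemma meval_homog (K : comNzRingType) (n d : nat) (p : {mpoly K[n]}) (c : K)
    (v : 'I_n -> K) :
  p \is d.-homog -> p.@[fun i => c * v i] = c ^+ d * p.@[v].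
Proof.
move=> /dhomogP hom_p; rewrite !mevalE mulr_sumr; apply: eq_big_seq => m mp.
rewrite mulrCA; congr (_ * _); have <- : mdeg m = d by apply: hom_p.
by rewrite mdegE -prodrXr -big_split; apply: eq_bigr => i _; rewrite exprMn.
Qed.

(** In characteristic zero ['X^d - 1] is separable, so it has [d] distinct roots; real ones have
    norm 1, hence lie in [[:: 1; -1]], which is too short for [3 <= d]. *)
Lemma nonreal_unity_root (R : rcfType) (d : nat) :
  (3 <= d)%N -> exists2 z : R[i], z ^+ d = 1 & complex.Im z != 0.
Proof.
move=> d3; have d0 : (0 < d)%N by apply: leq_trans d3.
have [r Dr] := closed_field_poly_normal ('X^d - 1 : {poly R[i]}).
move: Dr; rewrite (monicP (monicXnsubC _ d0)) scale1r => Dr.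
have uniq_r : uniq r.
  by rewrite -separable_prod_XsubC -Dr separable_Xn_sub_1 // pnatr_eq0 -lt0n.
have size_r : size r = d.
  by apply: succn_inj; rewrite -(size_prod_XsubC r id) -Dr size_XnsubC.
have r1 z : z \in r -> z ^+ d = 1.
  move=> zr; apply/eqP; rewrite -subr_eq0.
  have : root (\prod_(x <- r) ('X - x%:P)) z by rewrite root_prod_XsubC.
  by rewrite -Dr rootE !hornerE.
have [/hasP[z zr zi]|/hasPn real_r] :=
  boolP (has (fun z => complex.Im z != 0) r).
  by exists z => //; apply: r1.
suff /(uniq_leq_size uniq_r) : {subset r <= [:: 1; -1]}.
  by rewrite size_r leqNgt d3.
move=> z zr; move/(congr1 Num.norm): (r1 z zr).
rewrite normrX normr1 => /eqP; rewrite pexpr_eq1 // => /eqP nz.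
have rz : z \is Num.real.
  by move/negPn: (real_r z zr); case: (z) => a b /=; rewrite complex_real.
by rewrite (realEsign rz) nz mulr1 !inE; case: (_ < 0); rewrite eqxx ?orbT.
Qed.

Section NonMixed.
Variables (K : comNzRingType) (n d : nat) (f : sympoly K n).
Hypotheses (f_homog : f \is d.-homog) (f_non_mixed : non_mixed f).

Definition diagvar (k : 'I_(nvars n)) : bool :=
  (val (enum_val k)).1 == (val (enum_val k)).2.

Definition diagsupp (m : 'X_{1..nvars n}) : bool :=
  [forall k, ~~ diagvar k ==> (m k == 0%N)].

(** For non-mixed [f], the filter keeps exactly the off-diagonal monomials. *)
Definition offdiag_part : sympoly K n :=
  \sum_(m <- msupp f | ~~ diagsupp m) f@_m *: 'X_[m].

Lemma zvar_enum_val (k : 'I_(nvars n)) :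
  zvar (val (enum_val k)).1 (val (enum_val k)).2 = k.
Proof.
rewrite -[RHS]enum_valK; congr enum_rank; apply: val_inj => /=.
by case: (enum_val k) => -[i j] /= ->.
Qed.

Lemma offdiagonal_mon_diagvar (m : 'X_{1..nvars n}) (k : 'I_(nvars n)) :
  offdiagonal_mon m -> diagvar k -> m k = 0%N.
Proof.
case=> _ m0 /eqP kk; have /eqP := m0 (val (enum_val k)).1.
by rewrite mxE eqxx {2}kk zvar_enum_val pnatr_eq0 => /eqP.
Qed.

Lemma diagonal_mon_diagsupp (m : 'X_{1..nvars n}) :
  diagonal_mon m -> diagsupp m.
Proof.
move=> m0; apply/forallP => k; apply/implyP => kk; have /eqP := m0 _ _ kk.
by rewrite mxE ifN // zvar_enum_val mulf_eq0 invr_eq0 !pnatr_eq0 orbF.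
Qed.

(** A monomial of both kinds would have all exponents zero, and the constant is by convention not
    off-diagonal. *)
Lemma offdiagonal_mon_diagsupp (m : 'X_{1..nvars n}) :
  offdiagonal_mon m -> ~~ diagsupp m.
Proof.
move=> off_m; apply/negP => /forallP dm; case: (off_m) => /eqP[].
apply/mnmP => k; rewrite mnm0E.
have [dk|dk] := boolP (diagvar k); first exact: offdiagonal_mon_diagvar.
by apply/eqP; apply: implyP (dm k) dk.
Qed.

Lemma offdiag_part_homog : offdiag_part \is d.-homog.
Proof.
rewrite /offdiag_part big_seq_cond; apply: rpred_sum => m /andP[mf _].
by apply: dhomogZ; rewrite dhomogX; apply/eqP/(dhomogP _ _ _ f_homog).
Qed.

Lemma mcoeff_offdiag_part (m : 'X_{1..nvars n}) :
  offdiagonal_mon m -> offdiag_part@_m = f@_m.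
Proof.
move=> off_m; rewrite raddf_sum /=.
under eq_bigr do rewrite mcoeffZ mcoeffX.
have [mf|mf] := boolP (m \in msupp f).
  rewrite big_mkcond (bigD1_seq m) ?msupp_uniq //= eqxx mulr1.
  rewrite offdiagonal_mon_diagsupp // big1 ?addr0 // => i /negPf->.
  by rewrite mulr0 if_same.
rewrite (memN_msupp_eq0 mf) big_seq_cond big1 // => i /andP[fi _].
by case: eqP fi mf => [->->|]; rewrite ?mulr0.
Qed.

(** A diagonal monomial of degree [d] sees only [t] and contributes [t ^+ d]; an off-diagonal one
    sees only [v]. Non-mixedness leaves no other case. *)
Lemma meval_non_mixed (t : K) (v : 'I_(nvars n) -> K) :
  f.@[fun k => if diagvar k then t else v k] =
  (\sum_(m <- msupp f | diagsupp m) f@_m) * t ^+ d + offdiag_part.@[v].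
Proof.
rewrite mevalE (bigID diagsupp) /= mulr_suml raddf_sum /=; congr (_ + _).
  rewrite big_seq_cond [RHS]big_seq_cond; apply: eq_bigr => m.
  case/andP=> mf /forallP dm; congr (_ * _).
  have <- : mdeg m = d by apply: (dhomogP _ _ _ f_homog).
  rewrite mdegE -prodrXr; apply: eq_bigr => k _.
  by case: ifP (dm k) => //= _ /eqP->.
rewrite big_seq_cond [RHS]big_seq_cond; apply: eq_bigr => m.
case/andP=> mf ndm; rewrite mevalZ mevalX; congr (_ * _).
apply: eq_bigr => k _; case: ifP => // dk.
case: (f_non_mixed mf) => [/diagonal_mon_diagsupp dm|off_m].
  by rewrite dm in ndm.
by rewrite (offdiagonal_mon_diagvar off_m dk).
Qed.

End NonMixed.

Lemma posdefmx_scalar (R : realDomainType) (n : nat) (a : R) :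
  0 < a -> posdefmx (a%:M : 'M[R]_n).
Proof.
move=> a0; split=> [|x]; first exact: tr_scalar_mx.
rewrite mul_mx_scalar -scalemxAl mxE => nz_x; apply: mulr_gt0 => //.
have [i nz_xi] : exists i, x i 0 != 0.
  apply/existsP; apply: contraNT nz_x; rewrite negb_exists => /forallP x0.
  by apply/eqP/matrixP => i j; rewrite ord1 mxE; apply/eqP/negPn/x0.
rewrite mxE (bigD1 i) //= mxE -expr2 ltr_pwDl //.
  by rewrite exprn_even_gt0.
by apply: sumr_ge0 => j _; rewrite mxE -expr2 sqr_ge0.
Qed.

(** Since [v] is real, the matrix with diagonal [t] and off-diagonal entries from [v] has imaginary
    part [complex.Im t] times the identity. *)
Lemma psd_stable_scalar_diag (R : realType) (n : nat) (f : sympoly R[i] n)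
    (t : R[i]) (v : 'I_(nvars n) -> R) :
  psd_stable f -> 0 < complex.Im t ->
  f.@[fun k => if diagvar k then t else (v k)%:C%C] != 0.
Proof.
move=> stable_f t0.
pose M : 'M[R[i]]_n := \matrix_(i, j) if i == j then t else (v (zvar i j))%:C%C.
have symM : M^T = M.
  by apply/matrixP => i j; rewrite !mxE eq_sym zvarC.
have ImM : map_mx (@complex.Im R) M = (complex.Im t)%:M.
  by apply/matrixP => i j; rewrite !mxE; case: eqP.
have := stable_f M symM; rewrite ImM /eval_at => /(_ (posdefmx_scalar n t0)).
rewrite (meval_eq (v2 := fun k => if diagvar k then t else (v k)%:C%C)) //.
by move=> k; rewrite mxE zvar_enum_val.
Qed.

(** If some [d]-th root of [w] is real, it is nonzero, and multiplying it by a non-real [d]-th root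
    of unity makes it non-real. *)
Lemma nonreal_root (R : rcfType) (d : nat) (w : R[i]) :
  (3 <= d)%N -> w != 0 -> exists2 t : R[i], t ^+ d = w & complex.Im t != 0.
Proof.
move=> d3 nz_w; have d0 : (0 < d)%N by apply: leq_trans d3.
have [s sd] : exists s : R[i], s ^+ d = w by exists (d.-root w); rewrite rootCK.
have [im_s|] := eqVneq (complex.Im s) 0; last by exists s.
have [z zd im_z] := nonreal_unity_root R d3.
exists (s * z); first by rewrite exprMn zd mulr1.
have nz_s : s != 0.
  by apply: contraNneq nz_w => s0; rewrite -sd s0 expr0n gtn_eqF.
case: s z {sd zd} im_s im_z nz_s => [a b] [a' b'] /= -> nz_b'.
by rewrite eq_complex /= eqxx andbT mul0r addr0 mulf_eq0 negb_or => ->.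
Qed.

Theorem theorem5p4 (R : realType) (n d : nat) (f : sympoly R[i] n)
  (d_ge3 : (3 <= d)%N)
  (f_homog : f \is d.-homog)
  (f_non_mixed : non_mixed f)
  (f_offdiag : exists m : 'X_{1..nvars n}, offdiagonal_mon m /\ f@_m != 0) :
  ~ psd_stable f.
Proof.
move=> stable_f; case: f_offdiag => m0 [off_m0 nz_m0].
have d0 : (0 < d)%N by apply: leq_trans d_ge3.
set g := offdiag_part f.
have homog_g c v : g.@[fun k => c * v k] = c ^+ d * g.@[v].
  exact/meval_homog/offdiag_part_homog.
pose D := \sum_(m <- msupp f | diagsupp m) f@_m.
have stable t : 0 < complex.Im t ->
    forall v : 'I_(nvars n) -> R, D * t ^+ d + g.@[fun k => (v k)%:C%C] != 0.
  move=> t0 v; rewrite -meval_non_mixed //; exact: psd_stable_scalar_diag.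
have nz_D : D != 0.
  (* The test point is [t = 'i] with zero off-diagonal entries. *)
  have /stable : 0 < complex.Im ('i : R[i])%C by rewrite /= ltr01.
  move/(_ (fun=> 0)); apply: contraNneq => ->; rewrite mul0r add0r.
  (* [g 0 = 0]: apply [homog_g] with scaling factor [0] *)
  rewrite (meval_eq (v2 := fun k => 0 * 0)) => [|k]; last by rewrite mulr0.
  by rewrite homog_g expr0n gtn_eqF // mul0r.
(* The nonzero coefficient at [m0] belongs to [g] too, so [g] cannot vanish at all natural points.
   It remains to refute a point [v] where [g] is nonzero. *)
case/eqP: nz_m0; rewrite -(mcoeff_offdiag_part f off_m0) -/g.
apply: mcoeff_eq0_of_nat_roots => u; pose v k : R := (u k)%:R.
rewrite (meval_eq (v2 := fun k => (v k)%:C%C)) => [|k]; last first.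
  by rewrite rmorph_nat.
apply/eqP/negPn/negP => nz_gv.
have [t td im_t] : exists2 t : R[i],
    t ^+ d = - g.@[fun k => (v k)%:C%C] / D & complex.Im t != 0.
  by apply: nonreal_root; rewrite // mulf_neq0 ?oppr_eq0 ?invr_eq0.
have root_t : D * t ^+ d + g.@[fun k => (v k)%:C%C] = 0.
  by rewrite td mulrC divfK // addNr.
case: (ltrgt0P (complex.Im t)) im_t => // [/stable/(_ v)|im_t _].
  by rewrite root_t eqxx.
(* Negating both [t] and [v] multiplies the two terms by the same [(-1) ^+ d], so the zero persists
   while the imaginary part becomes positive. *)
have /stable/(_ (fun k => - v k)) : 0 < complex.Im (- t).
  by case: (t) im_t => a b /=; rewrite oppr_gt0.
rewrite (meval_eq (v2 := fun k => -1 * (v k)%:C%C)) => [|k]; last first.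
  by rewrite mulN1r rmorphN.
by rewrite homog_g exprNn mulrCA -mulrDr root_t mulr0 eqxx.
Qed.
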